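(* Let $k\ge 1$ and let $(M_1,\Omega_1,\mu_1,p_1)$ and $(M_1,\Omega_2,\mu_2,p_2)$ be $k$-integrable statistical models with $\mu_2$ a probability measure. Let $(\mathrm{Id},\Pi_* )$ be a restricted Markov morphism from the first model to the second, i.e. $p_2(x)=\Pi_*(p_1(x))$ for all $x\in M_1$, where $\Pi_*$ is $\mu_2$-representable by a positive Markov kernel $\Pi:\Omega_1\times\Omega_2\to\mathbb{R}$. Then $(\mathrm{Id},\Pi_* )$ is the composition of the inverse of a Markov morphism associated with a sufficient statistic, followed by a statistic. That is, there exist a statistical model $(M_1,\Omega_0,\mu_0,p_0)$, a statistic $\pi_1:\Omega_0\to\Omega_1$ that is sufficient for the parameter $x\in M_1$ of $(M_1,\Omega_0,\mu_0,p_0)$ and satisfies $(\pi_1)_*(p_0(x))=p_1(x)$ for all $x\in M_1$, and a statistic $\pi_2:\Omega_0\to\Omega_2$ satisfying $(\pi_2)_*(p_0(x))=\Pi_*(p_1(x))=p_2(x)$ for all $x\in M_1$.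
   Context: For a finite non-negative measure $\mu$ on a measurable space $\Omega$, $\mathcal M_+(\Omega,\mu)=\{\phi\mu:\phi\in L^1(\Omega,\mu),\ \phi>0\ \mu\text{-a.e.}\}$ with the $L^1$-topology, and $\mathcal P_+(\Omega,\mu)$ is its subset of probability measures. For $k\ge1$, a $k$-integrable parametrized measure model $(M,\Omega,\mu,p)$ consists of a smooth (finite or infinite dimensional) Banach manifold $M$, a finite reference measure $\mu$, and a continuous map $p:M\to\mathcal M_+(\Omega,\mu)$ for which there is a density potential $\bar p:M\times\Omega\to\mathbb{R}$, $p(x)=\bar p(x,\cdot)\mu$ for all $x$, such that: (i) for $\mu$-almost all $\omega$, $x\mapsto\ln\bar p(x,\omega)$ is defined and continuously Gâteaux-differentiable, i.e. $V\mapsto\partial_V\ln\bar p(x,\omega)$ is continuous on $TM$ and linear on each $T_xM$; (ii) for every continuous vector field $V$ on $M$, $\partial_V\ln\bar p(x,\cdot)\in L^k(\Omega,p(x))$ and $x\mapsto\|\partial_V\ln\bar p(x,\cdot)\|_{L^k(\Omega,p(x))}$ is continuous. It is a statistical model if $p(M)\subset\mathcal P_+(\Omega,\mu)$. All models here are $k$-integrable for the given $k$. A positive Markov (transition) kernel from $\Omega_1$ to $\mathcal P(\Omega_2,\mu_2)$ is a (jointly) measurable $\Pi:\Omega_1\times\Omega_2\to\mathbb{R}$ with $\Pi>0$ and $\int_{\Omega_2}\Pi(\omega_1,\omega_2)\,d\mu_2(\omega_2)=1$ for all $\omega_1$. It induces the ($\mu_2$-representable) Markov morphism $\Pi_*(\nu)(S)=\int_{\Omega_1}\int_S\Pi(\omega_1,\omega_2)\,d\mu_2(\omega_2)\,d\nu(\omega_1)$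 on finite measures $\nu$ on $\Omega_1$. A statistic is a measurable map $\kappa:\Omega_1\to\Omega_2$; it induces the Markov morphism $\kappa_*$ (push-forward). It is sufficient for the parameter $x\in M$ of $(M,\Omega_1,\mu_1,p_1)$ if there are $s:M\times\Omega_2\to\mathbb{R}$ with $s(x,\cdot)\in L^1(\Omega_2,\kappa_*\mu_1)$ for all $x$, and $t\in L^1(\Omega_1,\mu_1)$, such that for all $x\in M$, $\bar p_1(x,\omega_1)=s(x,\kappa(\omega_1))\,t(\omega_1)$ for $\mu_1$-a.e. $\omega_1$. *)

(* Defs.v *)
From HB Require Import structures.
From mathcomp Require Import all_boot all_order all_algebra.
From mathcomp Require Import all_classical all_reals all_analysis.

Set Implicit Arguments.
Unset Strict Implicit.
Unset Printing Implicit Defensive.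

Import Order.TTheory GRing.Theory Num.Theory.
Import numFieldNormedType.Exports.

Local Open Scope classical_set_scope.
Local Open Scope ring_scope.

(* [D n x [:: v1; ..; vn]] is the n-th Frechet derivative of f at x, applied to
   (v1, .., vn): a bounded n-linear form, with [D n.+1 x] the Frechet derivative
   at x of [D n] for the operator norm on bounded n-linear maps (whence the
   uniformity in the vectors of norm at most 1). The values of [D n x] on lists
   of length other than n are irrelevant. *)
Definition smooth_on (R : realType) (E F : normedModType R) (U : set E)
    (f : E -> F) : Prop :=
  exists D : nat -> E -> seq E -> F,
    (forall x, U x -> D 0%N x [::] = f x) /\
    forall n x, U x ->
      [/\ forall s1 s2 : seq E, (size s1 + size s2).+1 = n ->
            linear (fun v => D n x (s1 ++ v :: s2)),
          exists C : R, forall s : seq E, size s = n ->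
            (forall v, v \in s -> `|v| <= 1) -> `|D n x s| <= C &
          forall e : R, 0 < e -> \forall y \near x,
            forall s : seq E, size s = n -> (forall v, v \in s -> `|v| <= 1) ->
            `|D n y s - D n x s - D n.+1 x ((y - x) :: s)| <= e * `|y - x| ].

(* [chart_fun] and [chart_inv] are total functions that only matter on
   [chart_dom] and on its image respectively. *)
Record chart (R : realType) (M : topologicalType) (E : normedModType R) :=
  Chart {
    chart_dom : set M;
    chart_fun :> M -> E;
    chart_inv : E -> M;
    chart_dom_open : open chart_dom;
    chart_cod_open : open (chart_fun @` chart_dom);
    chart_funK : forall x, chart_dom x -> chart_inv (chart_fun x) = x;
    chart_fun_continuous : {within chart_dom, continuous chart_fun};
    chart_inv_continuous :
      {within chart_fun @` chart_dom, continuous chart_inv} }.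

Definition chart_cod (R : realType) (M : topologicalType)
    (E : normedModType R) (c : chart M E) : set E := c @` chart_dom c.

(* The Banach space may depend on the chart, so components of the manifold may
   be modelled on different spaces, of finite or infinite dimension. *)
Record banachManifold (R : realType) := BanachManifold {
  carrier :> topologicalType;
  carrier_hausdorff : hausdorff_space carrier;
  chart_index : Type;
  model : chart_index -> completeNormedModType R;
  atlas : forall i, chart carrier (model i);
  atlas_cover : forall x : carrier, exists i, chart_dom (atlas i) x;
  atlas_smooth : forall i j,
    smooth_on (atlas i @` (chart_dom (atlas i) `&` chart_dom (atlas j)))
      (atlas j \o chart_inv (atlas i)) }.

Section tangent.
Context (R : realType) (M : banachManifold R).

Definition chart_at (x : M) : chart_index M := projT1 (cid (atlas_cover x)).

(* T_x M, identified with the model space through one chart around x. *)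
Definition tangent (x : M) : Type := model (chart_at x).

(* Coordinates in the chart i of a tangent vector at x. *)
Definition tangent_coord (i : chart_index M) (x : M) (v : tangent x) : model i :=
  'd (atlas i \o chart_inv (atlas (chart_at x))) (atlas (chart_at x) x) v.

(* The charts of M induce the local trivialisations of T M, so a section is
   continuous exactly when its coordinates are. *)
Definition continuous_vector_field (V : forall x : M, tangent x) : Prop :=
  forall i, {within chart_dom (atlas i),
    continuous (fun x => tangent_coord i (V x))}.

Definition dirderiv (f : M -> R) (x : M) (v : tangent x) : R :=
  'D_v (f \o chart_inv (atlas (chart_at x))) (atlas (chart_at x) x).

(* Linearity on the fibres and continuity on T M are read in the local
   trivialisations (image of the chart) x (model space) of T M. *)
Definition continuously_gateaux (f : M -> R) : Prop :=
  forall i : chart_index M,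
    [/\ forall u w, chart_cod (atlas i) u ->
          derivable (f \o chart_inv (atlas i)) u w,
        forall u, chart_cod (atlas i) u ->
          linear (fun w => 'D_w (f \o chart_inv (atlas i)) u : R^o) &
        {within chart_cod (atlas i) `*` [set: model i],
          continuous (fun uw : model i * model i =>
            'D_(uw.2) (f \o chart_inv (atlas i)) uw.1)}].

End tangent.

Section models.
Context (R : realType) (d : measure_display) (T : measurableType d).
Implicit Types (mu nu : {measure set T -> \bar R}) (phi : T -> R).

(* nu = phi mu with phi in L^1(mu) *)
Definition is_density mu nu phi : Prop :=
  mu.-integrable setT (EFin \o phi) /\
  forall A, measurable A -> nu A = (\int[mu]_(w in A) (phi w)%:E)%E.

Definition Mplus mu : set {measure set T -> \bar R} :=
  [set nu | exists2 phi, is_density mu nu phi & {ae mu, forall w, 0 < phi w}].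

Definition Pplus mu : set {measure set T -> \bar R} :=
  [set nu | Mplus mu nu /\ nu setT = 1%E].

Variable M : banachManifold R.

(* M_+(Omega, mu) carries the L^1(mu)-distance of densities; densities are
   unique mu-almost everywhere, so their choice does not matter. *)
Definition L1_continuous mu (p : M -> {measure set T -> \bar R}) : Prop :=
  exists2 phi : M -> T -> R, (forall x, is_density mu (p x) (phi x)) &
    forall x0 : M,
      (\int[mu]_w `|phi x w - phi x0 w|%:E)%E @[x --> x0] --> 0%E.

(* The derivative of [ln pbar] is only meaningful for almost all w, so it is
   an element of L^k through an almost everywhere equal function g x. *)
Definition density_potential (k : R) mu (p : M -> {measure set T -> \bar R})
    (pbar : M -> T -> R) : Prop :=
  [/\ forall x, is_density mu (p x) (pbar x),
      {ae mu, forall w, (forall x, 0 < pbar x w) /\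
                        continuously_gateaux (fun x => ln (pbar x w))} &
      forall V : (forall x : M, tangent x), continuous_vector_field V ->
        exists g : M -> T -> R,
          [/\ forall x, {ae p x, forall w,
                g x w = dirderiv (fun y => ln (pbar y w)) (V x)},
              forall x, g x \in Lfun (p x) k%:E &
              continuous (fun x : M => fine ('N[p x]_(k%:E)[EFin \o g x]))] ].

Definition integrable_model (k : R) mu (p : M -> {measure set T -> \bar R}) :
    Prop :=
  [/\ forall x, Mplus mu (p x), L1_continuous mu p &
      exists pbar, density_potential k mu p pbar].

Definition statistical_model (k : R) mu (p : M -> {measure set T -> \bar R}) :
    Prop :=
  integrable_model k mu p /\ forall x, Pplus mu (p x).

End models.

Section statistics.
Context (R : realType) (d1 d2 : measure_display).
Context (T1 : measurableType d1) (T2 : measurableType d2).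

Definition positive_markov_kernel (mu2 : {measure set T2 -> \bar R})
    (Pi : T1 * T2 -> R) : Prop :=
  [/\ measurable_fun setT Pi, forall w, 0 < Pi w &
      forall w1, (\int[mu2]_w2 (Pi (w1, w2))%:E)%E = 1%E].

Definition markov_morphism (mu2 : {measure set T2 -> \bar R})
    (Pi : T1 * T2 -> R) (nu : {measure set T1 -> \bar R}) : set T2 -> \bar R :=
  fun S => (\int[nu]_w1 \int[mu2]_(w2 in S) (Pi (w1, w2))%:E)%E.

Definition sufficient (M : banachManifold R) (k : R)
    (mu1 : {measure set T1 -> \bar R}) (p1 : M -> {measure set T1 -> \bar R})
    (kappa : {mfun T1 >-> T2}) : Prop :=
  exists pbar1 : M -> T1 -> R, density_potential k mu1 p1 pbar1 /\
  exists (s : M -> T2 -> R) (t : T1 -> R),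
    [/\ forall x, (pushforward mu1 kappa).-integrable setT (EFin \o s x),
        mu1.-integrable setT (EFin \o t) &
        forall x, {ae mu1, forall w1, pbar1 x w1 = s x (kappa w1) * t w1}].

End statistics.

(* Main.v *)
(* Take Omega_0 = Omega_1 x Omega_2 and glue the kernel Pi to each measure nu on
   Omega_1, that is, form nu(dw1) Pi(w1, w2) mu2(dw2). The first marginal is nu
   because Pi has mass 1, and the second one is Pi_*(nu). With mu0 and p0 x glued
   from mu1 and p1 x, a density of p1 x with respect to mu1, composed with the
   first projection, is a density of p0 x with respect to mu0. Hence the first
   projection is sufficient with t = 1, and the integrability conditions are
   transported by the change of variables along it. *)
From HB Require Import structures.
Require Import Defs.
From mathcomp Require Import all_boot all_order all_algebra.
From mathcomp Require Import all_classical all_reals all_analysis.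
From mathcomp Require Import measurable_realfun.

Set Implicit Arguments.
Unset Strict Implicit.
Unset Printing Implicit Defensive.

Import Order.TTheory GRing.Theory Num.Theory.
Import numFieldNormedType.Exports.

Local Open Scope classical_set_scope.
Local Open Scope ring_scope.

(** * Construction of measures, and integration against mixtures of measures *)

Lemma exists_measure (R : realType) (d : measure_display) (T : measurableType d)
    (m : set T -> \bar R) :
  m set0 = 0%E -> (forall A, 0 <= m A)%E ->
  (forall F, (forall n, measurable (F n)) -> trivIset setT F ->
    m (\bigcup_n F n) = (\sum_(n <oo) m (F n))%E) ->
  exists n : {measure set T -> \bar R}, forall A, n A = m A.
Proof.
move=> m0 m_ge0 m_bigcup.
(* Nonnegativity already makes the partial sums converge, so the hypothesis only has to give the
   value of the series. *)
have m_sigma : semi_sigma_additive m.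
  move=> F mF tF mUF; rewrite m_bigcup//.
  exact: is_cvg_ereal_nneg_natsum_cond.
pose m_isMeasure := isMeasure.Build _ T R m m0 m_ge0 m_sigma.
pose n : {measure set T -> \bar R} := HB.pack m m_isMeasure.
by exists n.
Qed.

Lemma exists_density_measure (R : realType) (d : measure_display)
    (T : measurableType d) (mu : {measure set T -> \bar R}) (f : T -> \bar R) :
  measurable_fun setT f -> (forall w, 0 <= f w)%E ->
  exists n : {measure set T -> \bar R},
    forall A, n A = (\int[mu]_(w in A) f w)%E.
Proof.
move=> mf f0; apply: exists_measure => [|A|F mF tF].
- by rewrite integral_set0.
- exact: integral_ge0.
- by rewrite ge0_integral_bigcup//; exact: measurable_funTS.
Qed.

Lemma exists_mixture (R : realType) (d d' : measure_display)
    (T : measurableType d) (Z : measurableType d')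
    (mu : {measure set T -> \bar R}) (kap : T -> {measure set Z -> \bar R}) :
  (forall A, measurable A -> measurable_fun setT (kap ^~ A)) ->
  exists n : {measure set Z -> \bar R},
    forall A, n A = (\int[mu]_w kap w A)%E.
Proof.
move=> mkap; apply: exists_measure => [|A|F mF tF].
- by apply: integral0_eq => w _; rewrite measure0.
- exact: integral_ge0.
- rewrite -integral_nneseries//; last by move=> n; exact: mkap.
  apply: eq_integral => w _; rewrite measure_bigcup//.
  by apply: eq_eseriesl => n; rewrite in_setT.
Qed.

Section ge0_integral_mixture.
Import HBNNSimple.

(** Both sides respect increasing limits and nonnegative combinations, so the formula reduces to
    indicators, where it is the equation relating [n] to [kap]. It serves for densities, seen as
    mixtures of scaled Dirac measures, and for the kernel on the product. *)
Lemma ge0_integral_mixture (R : realType) (d d' : measure_display)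
    (T : measurableType d) (Z : measurableType d')
    (mu : {measure set T -> \bar R}) (kap : T -> {measure set Z -> \bar R})
    (n : {measure set Z -> \bar R}) (f : Z -> \bar R) :
  (forall A, measurable A -> measurable_fun setT (kap ^~ A)) ->
  (forall A, measurable A -> n A = (\int[mu]_w kap w A)%E) ->
  measurable_fun setT f -> (forall z, 0 <= f z)%E ->
  (\int[n]_z f z = \int[mu]_w \int[kap w]_z f z)%E.
Proof.
move=> mkap nE mf f0.
pose f_ := nnsfun_approx measurableT mf.
have f_lim z : (f z = limn (fun i => (f_ i z)%:E))%E.
  by apply/esym/cvg_lim => //; exact: cvg_nnsfun_approx.
(* Stated for every measure, since it is applied to [n] and to each [kap w]; the outer integral over
   [mu] then needs monotone convergence once more. *)
have f_mono (m : {measure set Z -> \bar R}) :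
    (\int[m]_z f z = limn (fun i => \int[m]_z (f_ i z)%:E))%E.
  under eq_integral do rewrite f_lim.
  rewrite monotone_convergence//.
  - by move=> i; exact/measurable_EFinP.
  - by move=> i z _; rewrite lee_fin.
  - by move=> z _ a b ab; rewrite lee_fin; exact/lefP/nd_nnsfun_approx.
rewrite f_mono; under [RHS]eq_integral do rewrite f_mono.
rewrite monotone_convergence//; last 3 first.
- move=> i; apply: measurable_fun_integral_kernel => //.
    by move=> z; rewrite lee_fin.
  exact/measurable_EFinP.
- by move=> i w _; apply: integral_ge0 => z _; rewrite lee_fin.
- move=> w _ a b ab; apply: ge0_le_integral => //.
  + by move=> z _; rewrite lee_fin.
  + exact/measurable_EFinP.
  + exact/measurable_EFinP.
  + by move=> z _; rewrite lee_fin; exact/lefP/nd_nnsfun_approx.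
congr (limn _); apply/funext => i; rewrite integralT_nnsfun sintegralE.
under [RHS]eq_integral do rewrite integralT_nnsfun sintegralE.
have mlev r : measurable (f_ i @^-1` [set r]) by exact: measurable_sfunP.
rewrite ge0_integral_fsum//; last 2 first.
- move=> r; apply: measurable_funeM; exact: mkap.
- by move=> r w _; exact: nnsfun_mulemu_ge0.
apply: eq_fsbigr => r _; rewrite nE//.
(* The sum runs over all reals [r], while [ge0_integralZl] pulls out a nonnegative scalar; for
   [r < 0] the level set is empty and both terms vanish. *)
have [r0|r0] := leP 0 r.
  by rewrite ge0_integralZl//; exact: mkap.
rewrite preimage_nnfun0//; under eq_integral do rewrite measure0.
by under [RHS]eq_integral do rewrite measure0 mule0; rewrite integral0 mule0.
Qed.

End ge0_integral_mixture.

(** * Transport of null sets, integrals and L^k-norms along a push-forward *)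

Lemma ae_pushforward (R : realType) (d d' : measure_display)
    (Z : measurableType d') (T : measurableType d) (f : {mfun Z >-> T})
    (m0 : {measure set Z -> \bar R}) (m1 : {measure set T -> \bar R})
    (P : T -> Prop) :
  (forall S, measurable S -> pushforward m0 f S = m1 S) ->
  {ae m1, forall w, P w} -> {ae m0, forall z, P (f z)}.
Proof.
move=> pushE [N [mN N0 PN]]; exists (f @^-1` N); split.
- by rewrite -[X in measurable X]setTI; exact: measurable_funPT.
- by rewrite -N0 -pushE.
- by move=> z /PN.
Qed.

Lemma ge0_integral_pushforwardE (R : realType) (d d' : measure_display)
    (Z : measurableType d') (T : measurableType d) (f : {mfun Z >-> T})
    (m0 : {measure set Z -> \bar R}) (m1 : {measure set T -> \bar R})
    (g : T -> \bar R) :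
  (forall S, measurable S -> pushforward m0 f S = m1 S) ->
  measurable_fun setT g -> (forall w, 0 <= g w)%E ->
  (\int[m0]_z g (f z) = \int[m1]_w g w)%E.
Proof.
move=> pushE mg g0.
rewrite [RHS](eq_measure_integral (pushforward m0 f)); last first.
  by move=> A mA _; exact/esym/pushE.
by rewrite [RHS]ge0_integral_pushforward.
Qed.

Lemma integrable_pushforwardE (R : realType) (d d' : measure_display)
    (Z : measurableType d') (T : measurableType d) (f : {mfun Z >-> T})
    (m0 : {measure set Z -> \bar R}) (m1 : {measure set T -> \bar R})
    (g : T -> \bar R) :
  (forall S, measurable S -> pushforward m0 f S = m1 S) ->
  m1.-integrable setT g -> m0.-integrable setT (g \o f).
Proof.
move=> pushE /integrableP[mg ig]; apply/integrableP; split.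
  exact: measurableT_comp.
rewrite (ge0_integral_pushforwardE (g := fun w => `|g w|%E) pushE)//.
exact: measurableT_comp.
Qed.

Lemma Lnorm_pushforwardE (R : realType) (k : R) (d d' : measure_display)
    (Z : measurableType d') (T : measurableType d) (f : {mfun Z >-> T})
    (m0 : {measure set Z -> \bar R}) (m1 : {measure set T -> \bar R})
    (g : T -> \bar R) :
  (forall S, measurable S -> pushforward m0 f S = m1 S) ->
  measurable_fun setT g -> ('N[m0]_(k%:E)[g \o f] = 'N[m1]_(k%:E)[g])%E.
Proof.
move=> pushE mg; rewrite unlock; congr poweR.
apply: (ge0_integral_pushforwardE (g := fun w => (`|g w| `^ k)%E) pushE).
- apply: (measurableT_comp (measurable_poweR _)).
  exact: measurableT_comp.
- by move=> w; exact: poweR_ge0.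
Qed.

Lemma Lfun_pushforward (R : realType) (k : R) (d d' : measure_display)
    (Z : measurableType d') (T : measurableType d) (f : {mfun Z >-> T})
    (m0 : {measure set Z -> \bar R}) (m1 : {measure set T -> \bar R})
    (g : T -> R) :
  (forall S, measurable S -> pushforward m0 f S = m1 S) ->
  g \in Lfun m1 k%:E -> g \o f \in Lfun m0 k%:E.
Proof.
move=> pushE gL.
have mg : measurable_fun setT g by have := sub_Lfun_mfun gL; rewrite inE.
have := sub_Lfun_finLfun gL; rewrite inE /finite_norm /= => gfin.
rewrite inE/=; apply/andP; split; rewrite inE/=; first exact: measurableT_comp.
rewrite /finite_norm (_ : EFin \o (g \o f) = (EFin \o g) \o f)//.
by rewrite (Lnorm_pushforwardE _ pushE)//; exact/measurable_EFinP.
Qed.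

(** * Densities and their lifts to mixtures *)

Lemma is_density_ae_eq (R : realType) (d : measure_display)
    (T : measurableType d) (mu nu : {measure set T -> \bar R})
    (phi psi : T -> R) :
  is_density mu nu phi -> is_density mu nu psi ->
  {ae mu, forall w, phi w = psi w}.
Proof.
move=> [iphi nuphi] [ipsi nupsi].
have : ae_eq mu setT (EFin \o phi) (EFin \o psi).
  apply: integral_ae_eq => //; first exact: measurable_int ipsi.
  by move=> E _ mE; rewrite /= -nuphi// -nupsi.
by apply: filterS => w /(_ I) [].
Qed.

(** [is_density] carries no sign condition; the sign comes from the positive density that [Mplus]
    provides, through almost everywhere uniqueness. *)
Lemma is_density_ge0 (R : realType) (d : measure_display)
    (T : measurableType d) (mu nu : {measure set T -> \bar R}) (phi : T -> R) :
  Mplus mu nu -> is_density mu nu phi -> {ae mu, forall w, 0 <= phi w}.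
Proof.
move=> [psi dpsi psi0] dphi.
have := is_density_ae_eq dphi dpsi.
by apply: filterS2 psi0 => w psiw ->; exact: ltW.
Qed.

(** The absolute value gives a nonnegative weight at every point, whereas [phi] itself is
    nonnegative only almost everywhere. *)
Lemma ge0_integral_density (R : realType) (d : measure_display)
    (T : measurableType d) (mu nu : {measure set T -> \bar R}) (phi : T -> R)
    (h : T -> \bar R) :
  is_density mu nu phi -> {ae mu, forall w, 0 <= phi w} ->
  measurable_fun setT h -> (forall w, 0 <= h w)%E ->
  (\int[nu]_w h w = \int[mu]_w (`|phi w|%:E * h w))%E.
Proof.
move=> [iphi nuE] phi0 mh h0.
have mphi : measurable_fun setT phi.
  by apply/measurable_EFinP; exact: measurable_int iphi.
have mnphi : measurable_fun setT (fun w => `|phi w|%:E).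
  by apply/measurable_EFinP; exact: measurableT_comp.
(* nu is the mixture over mu of the measures phi(w) delta_w *)
pose kap w : {measure set T -> \bar R} :=
  mscale (NngNum (normr_ge0 (phi w))) \d_w.
have kapE w A : kap w A = (`|phi w|%:E * (\1_A w)%:E)%E by [].
rewrite (@ge0_integral_mixture _ _ _ _ _ mu kap nu)//.
- apply: eq_integral => w _; rewrite ge0_integral_mscale//.
  by rewrite integral_dirac// diracT mul1e.
- move=> A mA; under eq_fun do rewrite kapE.
  apply: emeasurable_funM => //; apply/measurable_EFinP.
  exact: measurable_indic.
- move=> A mA; rewrite nuE// integral_mkcond.
  apply: ae_eq_integral => //.
  + apply/(measurable_restrictT _ _).1 => //; apply/measurable_EFinP.
    exact: measurable_funTS.
  + under eq_fun do rewrite kapE.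
    apply: emeasurable_funM => //; apply/measurable_EFinP.
    exact: measurable_indic.
  + apply: filterS phi0 => w phiw _; rewrite kapE epatch_indic/=.
    by rewrite ger0_norm.
Qed.

(* The second hypothesis expresses that kap w is carried by the fibre of f over w,
   which need not be a measurable set. *)
Lemma is_density_mixture (R : realType) (d d' : measure_display)
    (T : measurableType d) (Z : measurableType d') (f : {mfun Z >-> T})
    (kap : T -> {measure set Z -> \bar R})
    (mu nu : {measure set T -> \bar R}) (mu0 nu0 : {measure set Z -> \bar R})
    (phi : T -> R) :
  (forall A, measurable A -> measurable_fun setT (kap ^~ A)) ->
  (forall w A (g : T -> \bar R), measurable A -> measurable_fun setT g ->
    (forall w, 0 <= g w)%E ->
    (\int[kap w]_(z in A) g (f z) = g w * kap w A)%E) ->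
  (forall A, measurable A -> mu0 A = (\int[mu]_w kap w A)%E) ->
  (forall A, measurable A -> nu0 A = (\int[nu]_w kap w A)%E) ->
  (forall S, measurable S -> pushforward mu0 f S = mu S) ->
  {ae mu, forall w, 0 <= phi w} ->
  is_density mu nu phi -> is_density mu0 nu0 (phi \o f).
Proof.
move=> mkap kapf mu0E nu0E pushE phi0 dphi.
have [iphi _] := dphi.
have mphi : measurable_fun setT phi.
  by apply/measurable_EFinP; exact: measurable_int iphi.
have mnphi : measurable_fun setT (fun w => `|phi w|%:E).
  by apply/measurable_EFinP; exact: measurableT_comp.
split; first exact: (integrable_pushforwardE pushE iphi).
move=> A mA.
have mfphi : measurable_fun setT (fun z => `|phi (f z)|%:E).
  exact: (measurableT_comp mnphi).
rewrite nu0E// (ge0_integral_density dphi)//; last exact: mkap.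
(* The left side is now the [mu]-integral of [|phi w| * kap w A]. Disintegrating the middle term
   over [mu] gives the same, because [phi \o f] is constant on the fibre carrying [kap w]. The
   absolute value is then removed [mu0]-almost everywhere. *)
transitivity (\int[mu0]_(z in A) `|phi (f z)|%:E)%E.
  rewrite [RHS]integral_mkcond (ge0_integral_mixture mkap mu0E); last 2 first.
  - by apply/(measurable_restrictT _ _).1 => //; exact: measurable_funTS.
  - by move=> z; rewrite patchE; case: ifP.
  apply: eq_integral => w _; rewrite -integral_mkcond.
  by rewrite (kapf w A (fun w => `|phi w|%:E)).
apply: ae_eq_integral => //; first exact: measurable_funTS.
  apply: measurable_funTS; apply/measurable_EFinP; exact: measurableT_comp.
have := ae_pushforward pushE phi0.
by apply: filterS => z phiz _ /=; rewrite ger0_norm.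
Qed.

(** * Lifting a statistical model along a statistic *)

Section model_pushforward.
Context (R : realType) (k : R) (M : banachManifold R) (d d' : measure_display).
Context (Z : measurableType d') (T : measurableType d) (f : {mfun Z >-> T}).
Context (mu0 : {measure set Z -> \bar R}) (mu1 : {measure set T -> \bar R}).
Context (p0 : M -> {measure set Z -> \bar R}).
Context (p1 : M -> {measure set T -> \bar R}).
Hypothesis mu0E : forall S, measurable S -> pushforward mu0 f S = mu1 S.
Hypothesis p0E : forall x S, measurable S -> pushforward (p0 x) f S = p1 x S.
Hypothesis density_comp : forall x phi,
  is_density mu1 (p1 x) phi -> is_density mu0 (p0 x) (phi \o f).

(** Composition with [f] does not touch the dependence on [x], so regularity is inherited point by
    point and the L^k-norms are unchanged. [density_comp] is a separate hypothesis because the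
    push-forward equations determine [mu0] and [p0 x] only on preimages under [f]. *)
Lemma density_potential_comp (pbar : M -> T -> R) :
  density_potential k mu1 p1 pbar ->
  density_potential k mu0 p0 (fun x => pbar x \o f).
Proof.
move=> [dens reg dln]; split.
- by move=> x; exact: density_comp.
- exact: (ae_pushforward mu0E reg).
- move=> V /dln[g [gE gL gcont]]; exists (fun x => g x \o f); split.
  + by move=> x; exact: (ae_pushforward (p0E x) (gE x)).
  + by move=> x; exact: (Lfun_pushforward (p0E x)).
  + rewrite (_ : (fun x => _) =
      (fun x => fine ('N[p1 x]_(k%:E)[EFin \o g x])%E))//.
    apply/funext => x; congr fine.
    apply: (Lnorm_pushforwardE _ (g := EFin \o g x) (p0E x)).
    apply/measurable_EFinP.
    by have := sub_Lfun_mfun (gL x); rewrite inE.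
Qed.

Lemma statistical_model_comp :
  statistical_model k mu1 p1 -> statistical_model k mu0 p0.
Proof.
move=> [[p1M [phi phid phic] [pbar pbard]] p1P].
have p0M x : Mplus mu0 (p0 x).
  have [psi dpsi psi0] := p1M x.
  exists (psi \o f); first exact: density_comp.
  exact: (ae_pushforward mu0E psi0).
split; last first.
  move=> x; split; first exact: p0M.
  have [_ <-] := p1P x; exact: (p0E x measurableT).
split=> //; last first.
  by exists (fun x => pbar x \o f); exact: density_potential_comp.
exists (fun x => phi x \o f); first by move=> x; exact: density_comp.
move=> x0; have mphi x : measurable_fun setT (phi x).
  have [iphi _] := phid x; apply/measurable_EFinP.
  exact: measurable_int iphi.
(* Lifting preserves the L^1-distance of densities, so continuity is that of [p1]. *)
rewrite (_ : (fun x => _) = (fun x => \int[mu1]_w `|phi x w - phi x0 w|%:E)%E).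
  exact: phic.
apply/funext => x.
apply: (ge0_integral_pushforwardE
  (g := fun w => `|phi x w - phi x0 w|%:E) mu0E).
  apply/measurable_EFinP; apply: measurableT_comp => //.
  exact: measurable_funB.
by move=> w; rewrite lee_fin.
Qed.

End model_pushforward.

(** * The kernel on the product, and the glued model *)

Lemma exists_graph_kernel (R : realType) (d1 d2 : measure_display)
    (T1 : measurableType d1) (T2 : measurableType d2)
    (mu2 : {sigma_finite_measure set T2 -> \bar R}) (Pi : T1 * T2 -> R) :
  measurable_fun setT Pi -> (forall w, 0 < Pi w) ->
  exists kap : T1 -> {measure set (T1 * T2) -> \bar R},
    [/\ forall w1 A, kap w1 A =
          (\int[mu2]_(w2 in pair w1 @^-1` A) (Pi (w1, w2))%:E)%E,
        forall A, measurable A -> measurable_fun setT (kap ^~ A) &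
        forall w A (g : T1 -> \bar R), measurable A -> measurable_fun setT g ->
          (forall w, 0 <= g w)%E ->
          (\int[kap w]_(z in A) g z.1 = g w * kap w A)%E].
Proof.
move=> mPi Pi0.
(* [lam w1] is the measure with density [Pi (w1, _)] with respect to [mu2]; [kap w1] is its image on
   the slice over [w1]. *)
have /choice[lam lamE] : forall w1, exists n : {measure set T2 -> \bar R},
    forall A, n A = (\int[mu2]_(w2 in A) (Pi (w1, w2))%:E)%E.
  move=> w1; apply: exists_density_measure => [|w2]; last by rewrite lee_fin ltW.
  apply/measurable_EFinP; exact: measurable_fun_pair2.
have /choice[kap kap_push] : forall w1,
    exists n : {measure set (T1 * T2) -> \bar R},
      forall A, n A = pushforward (lam w1) (pair w1) A.
  move=> w1; unshelve eexists (pushforward (lam w1) (pair w1)) => //.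
have kapE w1 A : kap w1 A =
    (\int[mu2]_(w2 in pair w1 @^-1` A) (Pi (w1, w2))%:E)%E.
  by rewrite kap_push -lamE.
exists kap; split => //.
- move=> A mA; under eq_fun do rewrite kapE integral_mkcond.
  (* Cutting off by the indicator of [A] on the product turns the slice integral into a partial
     integral of [F], measurable by Tonelli since [mu2] is sigma-finite. *)
  pose F (z : T1 * T2) := ((\1_A z)%:E * (Pi z)%:E)%E.
  have -> : (fun w1 => \int[mu2]_w2
      ((fun w2 => (Pi (w1, w2))%:E) \_ (pair w1 @^-1` A)) w2)%E = fubini_F mu2 F.
    apply/funext => w1; apply: eq_integral => w2 _.
    rewrite epatch_indic /F /= muleC; congr (_ * _)%E.
  apply: measurable_fun_fubini_tonelli_F.
    apply: emeasurable_funM; apply/measurable_EFinP => //.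
  by move=> z; rewrite /F mule_ge0// lee_fin// ltW.
- move=> w A g mA mg g0.
  have mpair : measurable_fun setT (pair w : T2 -> T1 * T2).
    exact: pair1_measurable.
  (* After the change of variables along [pair w], the first coordinate is constantly [w], so the
     integrand is the constant [g w]. *)
  rewrite (eq_measure_integral (pushforward (lam w) (pair w))) => //.
  rewrite ge0_integral_pushforward//; last first.
    by apply: measurable_funTS; exact: measurableT_comp.
  rewrite (eq_integral (cst (g w)))// integral_cst// ?kap_push//.
  by rewrite -[X in measurable X]setTI; exact: mpair.
Qed.

Theorem theorem4p10 (R : realType) (k : R) (M1 : banachManifold R)
    (d1 d2 : measure_display) (T1 : measurableType d1) (T2 : measurableType d2)
    (mu1 : {finite_measure set T1 -> \bar R}) (mu2 : probability T2 R)
    (p1 : M1 -> {measure set T1 -> \bar R})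
    (p2 : M1 -> {measure set T2 -> \bar R})
    (Pi : T1 * T2 -> R) :
  1 <= k ->
  statistical_model k mu1 p1 ->
  statistical_model k mu2 p2 ->
  positive_markov_kernel mu2 Pi ->
  (forall x S, measurable S -> p2 x S = markov_morphism mu2 Pi (p1 x) S) ->
  exists (d0 : measure_display) (T0 : measurableType d0)
    (mu0 : {finite_measure set T0 -> \bar R})
    (p0 : M1 -> {measure set T0 -> \bar R})
    (pi1 : {mfun T0 >-> T1}) (pi2 : {mfun T0 >-> T2}),
    [/\ statistical_model k mu0 p0,
        sufficient k mu0 p0 pi1,
        (forall x S, measurable S -> pushforward (p0 x) pi1 S = p1 x S) &
        (forall x S, measurable S ->
           pushforward (p0 x) pi2 S = markov_morphism mu2 Pi (p1 x) S /\
           markov_morphism mu2 Pi (p1 x) S = p2 x S)].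
Proof.
move=> _ p1_model _ [mPi Pi_gt0 Pi_prob] p2E.
have [kap [kapE mkap kap_fst]] := exists_graph_kernel mu2 mPi Pi_gt0.
have /choice[mix mixE] : forall nu : {measure set T1 -> \bar R},
    exists n : {measure set (T1 * T2) -> \bar R},
      forall A, n A = (\int[nu]_w kap w A)%E.
  by move=> nu; exact: exists_mixture.
pose pi1 : {mfun (T1 * T2)%type >-> T1} := mfun_Sub (mem_set measurable_fst).
pose pi2 : {mfun (T1 * T2)%type >-> T2} := mfun_Sub (mem_set measurable_snd).
(* Over [w], the slice of the cylinder on [S] is all of [T2], of mass 1, if [w] lies in [S], and
   empty otherwise. *)
have mix_fst nu S : measurable S -> pushforward (mix nu) pi1 S = nu S.
  move=> mS; rewrite /pushforward mixE.
  transitivity (\int[nu]_w (\1_S w)%:E)%E; last first.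
    by rewrite integral_indic// setIT.
  apply: eq_integral => w _; rewrite kapE.
  have [wS|wS] := boolP (w \in S).
    rewrite indicE wS (_ : _ @^-1` _ = setT) ?Pi_prob//.
    by apply/seteqP; split => // w2 _; exact: set_mem wS.
  rewrite indicE (negbTE wS) (_ : _ @^-1` _ = set0) ?integral_set0//.
  by apply/seteqP; split => // w2 /mem_set; apply/negP.
have mix_fin : (mix mu1 setT < +oo)%E.
  rewrite -[mix mu1 _]/(pushforward (mix mu1) pi1 setT) mix_fst//.
  by rewrite ltey_eq fin_num_measure.
(* Restricting to the whole space changes no value; it equips [mix mu1] with the structure of a
   finite measure. *)
pose mu0 : {finite_measure set (T1 * T2)%type -> \bar R} :=
  mfrestr measurableT mix_fin.
have mu0_mix A : mu0 A = mix mu1 A by rewrite /mu0/= /mfrestr /mrestr setIT.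
pose p0 x := mix (p1 x).
have p0E x S : measurable S -> pushforward (p0 x) pi1 S = p1 x S.
  exact: mix_fst.
have mu0E S : measurable S -> pushforward mu0 pi1 S = mu1 S.
  by move=> mS; rewrite /pushforward mu0_mix; exact: mix_fst.
have density_comp x phi :
    is_density mu1 (p1 x) phi -> is_density mu0 (p0 x) (phi \o pi1).
  move=> dphi; have [[p1M _ _] _] := p1_model.
  apply: (is_density_mixture (f := pi1) (nu := p1 x) (mu := mu1) mkap) => //.
  - by move=> A _; exact: etrans (mu0_mix A) (mixE _ A).
  - by move=> A _; exact: mixE.
  - exact: is_density_ge0 (p1M x) dphi.
exists _, (T1 * T2)%type, mu0, p0, pi1, pi2; split => //.
- exact: (statistical_model_comp mu0E p0E density_comp).
- have [[_ _ [pbar pbar_pot]] _] := p1_model.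
  exists (fun x => pbar x \o pi1); split.
    exact: (density_potential_comp mu0E p0E density_comp).
  have [pbar_dens _ _] := pbar_pot.
  (* Integrability of [pbar x] is lifted from [mu1] to [mu0], then pushed down to the image of [mu0]
     under [pi1]; the constant 1 is integrable because [mu0] is finite. *)
  exists pbar, (cst 1); split => [x||x].
  + have [ipbar _] := pbar_dens x.
    apply: integrable_pushforward => //.
      exact: measurable_int ipbar.
    exact: (integrable_pushforwardE mu0E).
  + exact: finite_measure_integrable_cst.
  + by apply/nearW => z /=; rewrite mulr1.
- move=> x S mS; rewrite -p2E//; split => //.
  (* The slice over any [w1] of the preimage of [S] under [pi2] is [S] itself, so [kapE] yields the
     inner integral of the Markov morphism. *)
  rewrite p2E// /markov_morphism /pushforward mixE.
  by apply: eq_integral => w1 _; rewrite kapE.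
Qed.
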